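(* Let $S$ be a finite Kleene relation algebra satisfying the Tarski rule, containing elements $\mathsf{Z}, \mathsf{S}$ such that $\mathsf{Z}$ is a point, $\mathsf{S}$ is an injective mapping and $(\mathsf{S}^T)^*\cdot\mathsf{Z} = \top$; let $\mathsf{S'} = \mathsf{S}\sqcap\overline{\mathsf{Z}^T}$. For $p \in S$ and a point $x$ let $\mathrm{root}(p,x) = ((p^T)^*\cdot x)\sqcap((p\sqcap 1)\cdot\top)$, and for a vector $v$ and $z\in S$ let $p[v\mapsto z] = (v\sqcap z^T)\sqcup(\overline v\sqcap p)$. Say $(p,\mathit{rank})$ has the rank property if $\mathit{rank}$ is a mapping, $(p\sqcap\overline{1})\cdot\mathit{rank}\sqsubseteq \mathit{rank}\cdot\mathsf{S'}^+$, and there exists an injective univalent $i\in S$ with $(p\sqcap 1)\cdot\top \sqsubseteq i\cdot\overline{\mathsf{S'}^+\cdot\mathit{rank}^T\cdot\top}$. Let $p_0$ be a forest, $x, y$ points, and $\mathit{rank}_0\in S$ such that $(p_0,\mathit{rank}_0)$ has the rank property. Run, from $p = p_0$, $\mathit{rank} = \mathit{rank}_0$, the program: $r := \mathrm{root}(p,x)$; $p := p[(p^T)^*\cdot x\mapsto r]$; $s := \mathrm{root}(p,y)$; $p := p[(p^T)^*\cdot y \mapsto s]$; if $r\neq s$ then (if $\mathit{rank}^T\cdot r \sqsubseteq \mathsf{S'}^+\cdot\mathit{rank}^T\cdot s$ then $p := p[r\mapsto s]$ else ($p := p[s\mapsto r]$; if $\mathit{rank}^T\cdot r = \mathit{rank}^T\cdot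 s$ then $\mathit{rank} := \mathit{rank}[r\mapsto \mathsf{S'}^T\cdot\mathit{rank}^T\cdot r]$)). Then in the final state $p$ is a forest, $x$ and $y$ are points, $p^*\cdot(p^T)^* = (p_0\sqcup x\cdot y^T\sqcup (p_0\sqcup x\cdot y^T)^T)^*$, and $(p,\mathit{rank})$ has the rank property.
   Context: A Kleene relation algebra is a structure $(S,\sqcup,\sqcap,\cdot,\overline{\phantom{x}},{}^T,{}^*,\bot,\top,1)$ such that $(S,\sqcup,\sqcap,\overline{\phantom{x}},\bot,\top)$ is a Boolean algebra with order $x \sqsubseteq y \iff x \sqcup y = y$; $(S,\sqcup,\cdot,\bot,1)$ is an idempotent semiring ($\cdot$ associative with two-sided unit $1$, distributing over $\sqcup$, $\bot$ a two-sided zero of $\cdot$); transposition satisfies $(x\sqcup y)^T = x^T \sqcup y^T$, $(x^T)^T = x$, $(x\cdot y)^T = y^T\cdot x^T$ and $(x\cdot y)\sqcap z \sqsubseteq x\cdot(y\sqcap(x^T\cdot z))$; and the star satisfies $1\sqcup y\cdot y^* = y^* = 1 \sqcup y^*\cdot y$, $z\sqcup y\cdot x\sqsubseteq x \Rightarrow y^*\cdot z\sqsubseteq x$, $z \sqcup x\cdot y \sqsubseteq x \Rightarrow z\cdot y^*\sqsubseteq x$. The Tarski rule states $\top\cdot x\cdot\top = \top$ for every $x \neq \bot$. Write $x^+ = x\cdot x^*$. An element $x$ is univalent if $x^T x\sqsubseteq 1$, total if $1\sqsubseteq x x^T$, a mapping if univalent and total, injective if $x x^T\sqsubseteq 1$,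 surjective if $1\sqsubseteq x^T x$, a vector if $x\cdot\top = x$, a point if it is an injective surjective vector, acyclic if $x^+\sqsubseteq\overline 1$, and a forest if it is a mapping and $x\sqcap\overline{1}$ is acyclic. Programs are sequential with the usual semantics. Ranks are numbers encoded as points: $\mathsf{Z}$ is $0$, $\mathsf{S'}^T\cdot n$ is the successor of $n$, and $n < m$ means $n\sqsubseteq\mathsf{S'}^+\cdot m$; $\mathit{rank}^T\cdot r$ is the rank of node $r$. The existence of the injective univalent $i$ expresses that the number of roots is at most the number of ranks not below the maximal rank. In the program, $p[(p^T)^*x\mapsto r]$ is path compression (setting every ancestor of $x$ to point to its root $r$). *)

(* Defs.v *)
From HB Require Import structures.
From mathcomp Require Import all_boot all_order.

Set Implicit Arguments.
Unset Strict Implicit.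
Unset Printing Implicit Defensive.

Import Order.TTheory.
Local Open Scope order_scope.

Declare Scope kra_scope.
Delimit Scope kra_scope with KRA.

(* The Boolean algebra is MathComp's complemented distributive lattice, whose
   order satisfies (x <= y) = (x `|` y == y) by leEjoin.  Being bounded, it may
   be trivial (\bot = \top), as in the axioms of Kleene relation algebras. *)
HB.mixin Record CTBDistrLattice_isKleeneRelAlg (d : Order.disp_t) A
    of Order.CTBDistrLattice d A := {
  kone  : A;
  kmul  : A -> A -> A;
  kconv : A -> A;
  kstar : A -> A;
  kmulA  : forall x y z : A, kmul x (kmul y z) = kmul (kmul x y) z;
  kmul1x : forall x : A, kmul kone x = x;
  kmulx1 : forall x : A, kmul x kone = x;
  kmulUl : forall x y z : A, kmul (x `|` y) z = kmul x z `|` kmul y z;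
  kmulUr : forall x y z : A, kmul x (y `|` z) = kmul x y `|` kmul x z;
  kmul0x : forall x : A, kmul \bot x = \bot;
  kmulx0 : forall x : A, kmul x \bot = \bot;
  kconvU : forall x y : A, kconv (x `|` y) = kconv x `|` kconv y;
  kconvK : forall x : A, kconv (kconv x) = x;
  kconvM : forall x y : A, kconv (kmul x y) = kmul (kconv y) (kconv x);
  kdedekind : forall x y z : A,
    kmul x y `&` z <= kmul x (y `&` kmul (kconv x) z);
  kstar_unfoldl : forall y : A, kone `|` kmul y (kstar y) = kstar y;
  kstar_unfoldr : forall y : A, kone `|` kmul (kstar y) y = kstar y;
  kstar_inductl : forall x y z : A,
    z `|` kmul y x <= x -> kmul (kstar y) z <= x;
  kstar_inductr : forall x y z : A,
    z `|` kmul x y <= x -> kmul z (kstar y) <= x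
}.

#[short(type="kleeneRelAlgType")]
HB.structure Definition KleeneRelAlg (d : Order.disp_t) :=
  { A of Order.CTBDistrLattice d A & CTBDistrLattice_isKleeneRelAlg d A }.

#[short(type="finKleeneRelAlgType")]
HB.structure Definition FinKleeneRelAlg (d : Order.disp_t) :=
  { A of Order.FinCTBDistrLattice d A & CTBDistrLattice_isKleeneRelAlg d A }.

Notation "1" := kone : kra_scope.
Notation "x * y" := (kmul x y) : kra_scope.
Notation "x ^T" := (kconv x) : kra_scope.
Notation "x ^*" := (kstar x) : kra_scope.

Local Open Scope kra_scope.

Section RelationalNotions.
Context {d : Order.disp_t} {A : kleeneRelAlgType d}.
Implicit Types (x y z p v rank : A).

Definition tarski_rule (B : kleeneRelAlgType d) : Prop :=
  forall x : B, x != \bot -> \top * x * \top = \top.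

Definition kplus x : A := x * x^*.

Definition kunivalent x : bool := x^T * x <= 1.
Definition ktotal x : bool := 1 <= x * x^T.
Definition kmapping x : bool := kunivalent x && ktotal x.
Definition kinjective x : bool := x * x^T <= 1.
Definition ksurjective x : bool := 1 <= x^T * x.
Definition kvector x : bool := x * \top == x.
Definition kpoint x : bool := [&& kinjective x, ksurjective x & kvector x].
Definition kacyclic x : bool := kplus x <= ~` 1.
Definition kforest x : bool := kmapping x && kacyclic (x `&` ~` 1).

Definition kroot p x : A := (p^T^* * x) `&` ((p `&` 1) * \top).

(* kupdate p v z is p[v |-> z]: the rows in the vector v are replaced by z^T. *)
Definition kupdate p v z : A := (v `&` z^T) `|` (~` v `&` p).

(* S' : the successor relation with the transitions into Z removed. *)
Definition succ' (Z S : A) : A := S `&` ~` Z^T.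

Definition rank_property (S' p rank : A) : Prop :=
  [/\ kmapping rank,
      (p `&` ~` 1) * rank <= rank * kplus S' &
      exists i : A, [/\ kinjective i, kunivalent i &
        (p `&` 1) * \top <= i * ~` (kplus S' * rank^T * \top)]].

End RelationalNotions.

(* Commands are state transformers: the program below has no loops, so
   every run terminates in a unique final state. *)
Section Programs.
Context {d : Order.disp_t} {A : kleeneRelAlgType d}.

Record state := State {
  var_p : A; var_rank : A; var_x : A; var_y : A; var_r : A; var_s : A
}.

Definition command := state -> state.
Definition expr := state -> A.
Definition test := state -> bool.

Definition skip : command := fun st => st.
Definition seq_cmd (c1 c2 : command) : command := fun st => c2 (c1 st).
Definition ifte (b : test) (c1 c2 : command) : command :=
  fun st => if b st then c1 st else c2 st.

Definition assign_p (e : expr) : command := fun st =>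
  State (e st) (var_rank st) (var_x st) (var_y st) (var_r st) (var_s st).
Definition assign_rank (e : expr) : command := fun st =>
  State (var_p st) (e st) (var_x st) (var_y st) (var_r st) (var_s st).
Definition assign_r (e : expr) : command := fun st =>
  State (var_p st) (var_rank st) (var_x st) (var_y st) (e st) (var_s st).
Definition assign_s (e : expr) : command := fun st =>
  State (var_p st) (var_rank st) (var_x st) (var_y st) (var_r st) (e st).

End Programs.

Arguments state {d} A.
Arguments command {d} A.

Declare Scope cmd_scope.
Delimit Scope cmd_scope with cmd.
Bind Scope cmd_scope with command.
Notation "c1 ;; c2" := (seq_cmd c1 c2)
  (at level 90, right associativity) : cmd_scope.

Section UnionByRank.
Context {d : Order.disp_t} {A : kleeneRelAlgType d}.
Variable S' : A.

Let p : state A -> A := @var_p d A.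
Let rank : state A -> A := @var_rank d A.
Let x : state A -> A := @var_x d A.
Let y : state A -> A := @var_y d A.
Let r : state A -> A := @var_r d A.
Let s : state A -> A := @var_s d A.

Definition union_by_rank : command A := (
  assign_r (fun st => kroot (p st) (x st)) ;;
  assign_p (fun st => kupdate (p st) ((p st)^T^* * x st) (r st)) ;;
  assign_s (fun st => kroot (p st) (y st)) ;;
  assign_p (fun st => kupdate (p st) ((p st)^T^* * y st) (s st)) ;;
  ifte (fun st => r st != s st)
    (ifte (fun st => (rank st)^T * r st <= kplus S' * (rank st)^T * s st)
      (assign_p (fun st => kupdate (p st) (r st) (s st)))
      (assign_p (fun st => kupdate (p st) (s st) (r st)) ;;
       ifte (fun st => (rank st)^T * r st == (rank st)^T * s st)
         (assign_rank
            (fun st => kupdate (rank st) (r st) (S'^T * (rank st)^T * r st)))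
         skip))
    skip)%cmd.

End UnionByRank.

(* Main.v *)
(* The hypothesis S^T^* * Z = \top makes \top the join of the points (S^T)^n * Z.
   With the Tarski rule, points are atoms among the vectors, so a nontrivial A is
   isomorphic to the algebra of all relations between its finitely many points:
   el a u v says that (u, v) is in the relation a.  Mappings become functions,
   S becomes a cyclic successor, and x < y for ranks compares the distances from Z.
   Everything then reduces to functions f whose ranks strictly increase along
   non-root steps.  Iterating f reaches the root of every node, path compression
   does not change the roots, and a link replaces one root by another.  A
   link removes one root, while incrementing a rank removes at most one of the
   ranks not below the maximum; two roots leave at least two such ranks, so the
   incremented rank does not wrap around. *)
Require Import Defs.
From mathcomp Require Import all_boot all_order zify.

Set Implicit Arguments.
Unset Strict Implicit.
Unset Printing Implicit Defensive.

(** * Increasing functions and their roots *)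

Section ForestFunctions.
Local Open Scope nat_scope.
Variable T : finType.
Implicit Types (f g : T -> T) (rk : T -> nat) (u v w x y r s : T).

Definition increasing rk f := forall u, f u != u -> rk u < rk (f u).

(** Ranks below [#|T|] leave no room for [#|T|] strict increases, so this many iterations always end
    at a fixed point. *)
Definition root_of f u := iter #|T| f u.

Definition compress f x u := if fconnect f x u then root_of f x else f u.

Definition link f r s u := if u == r then s else f u.

Lemma fconnect_ltn rk f u w :
  increasing rk f -> fconnect f u w -> u != w -> rk u < rk w.
Proof.
move=> inc /connectP[q fq ->]; elim: q u fq => [|v q IHq] u /=; first by rewrite eqxx.
case/andP=> /eqP <- /IHq; have [fuu|fuu] := eqVneq (f u) u; first by rewrite fuu.
by have [<- _ _|_ /(_ isT) ? _] := eqVneq (f u) (last (f u) q); have := inc u fuu; lia.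
Qed.

Lemma card_le_inj_on (P Q : {set T}) :
  (#|P| <= #|Q| <-> exists h : T -> T, {in P &, injective h} /\ {in P, forall u, h u \in Q}).
Proof.
split=> [PQ|[h [hinj hQ]]]; last first.
  rewrite -(card_in_imset hinj); apply/subset_leq_card/subsetP => _ /imsetP[u uP ->].
  exact: hQ.
(* The n-th element of [P] goes to the n-th element of [Q]; the default [u] is never reached on
   [P]. *)
exists (fun u => nth u (enum Q) (index u (enum P))); split=> [u v uP vP|u uP].
  have iQ t : t \in P -> index t (enum P) < size (enum Q).
    by move=> tP; rewrite -cardE (leq_trans _ PQ) // cardE index_mem mem_enum.
  rewrite (set_nth_default v) ?iQ // => /eqP.
  rewrite nth_uniq ?enum_uniq ?iQ // => /eqP /(congr1 (nth u (enum P))).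
  by rewrite !nth_index ?mem_enum.
by rewrite -mem_enum mem_nth // -cardE (leq_trans _ PQ) // cardE index_mem mem_enum.
Qed.

Section Roots.
Variables (rk : T -> nat) (f : T -> T).
Hypotheses (rk_lt : forall u, rk u < #|T|) (inc : increasing rk f).

(** After [n] steps either a fixed point has been reached or the rank is at least [n]; for
    [n = #|T|] the bound on ranks excludes the second case. *)
Lemma root_of_fix u : f (root_of f u) = root_of f u.
Proof.
have : (#|T| <= rk (root_of f u)) || (f (root_of f u) == root_of f u).
  rewrite /root_of; elim: #|T| => //= n; set w := iter n f u => IHn.
  have [fw|/inc fw] := eqVneq (f w) w; first by rewrite !fw eqxx orbT.
  by move: IHn; case: eqP => [fw'|_]; [move: fw; rewrite fw' ltnn | lia].
by rewrite leqNgt rk_lt => /eqP.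
Qed.

Lemma fconnect_root u : fconnect f u (root_of f u).
Proof. exact: fconnect_iter. Qed.

(** Invariance carries the value of [g] from [u] to its root, where the second condition determines
    it. The roots after a compression or a link are computed this way. *)
Lemma root_of_unique g :
  (forall u, g (f u) = g u) -> (forall u, f u = u -> g u = u) -> root_of f =1 g.
Proof.
move=> gf gfix u; rewrite -(gfix _ (root_of_fix u)) /root_of.
by elim: #|T| => //= n <-; rewrite gf.
Qed.

Lemma root_of_step u : root_of f (f u) = root_of f u.
Proof. by rewrite {1}/root_of -iterSr /= root_of_fix. Qed.

Lemma root_of_fixed u : f u = u -> root_of f u = u.
Proof. by move=> fu; rewrite /root_of; elim: #|T| => //= n ->. Qed.

Lemma root_of_connect u w : fconnect f u w -> root_of f u = root_of f w.
Proof.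
move=> /connectP[q fq ->]; elim: q u fq => //= v q IHq u /andP[/eqP <- /IHq <-].
by rewrite root_of_step.
Qed.

(** The left side is the pointwise reading of [kroot]. *)
Lemma root_ofP u w : fconnect f u w && (f w == w) = (w == root_of f u).
Proof.
apply/andP/eqP => [[/root_of_connect -> /eqP /root_of_fixed -> //]|->].
by rewrite fconnect_root root_of_fix.
Qed.

Lemma compress_fix x u : (compress f x u == u) = (f u == u).
Proof.
rewrite /compress; case: ifP => // xu; rewrite (root_of_connect xu).
by apply/eqP/eqP => [<-|/root_of_fixed //]; rewrite root_of_fix.
Qed.

Lemma increasing_compress x : increasing rk (compress f x).
Proof.
move=> u; rewrite /compress; case: ifP => [xu|_]; last exact: inc.
rewrite (root_of_connect xu) eq_sym; exact: fconnect_ltn inc (fconnect_root u).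
Qed.

End Roots.

Lemma root_of_compress rk f x :
  (forall u, rk u < #|T|) -> increasing rk f -> root_of (compress f x) =1 root_of f.
Proof.
move=> rk_lt inc; apply: (root_of_unique rk_lt).
- exact: increasing_compress rk_lt _ _.
- move=> u; rewrite /compress; case: ifP => [/(root_of_connect rk_lt inc) xu|_].
    by rewrite (root_of_fixed (root_of_fix rk_lt inc _)).
  exact: root_of_step rk_lt inc _.
- by move=> u /eqP; rewrite (compress_fix rk_lt inc) => /eqP /root_of_fixed.
Qed.

(** Two rankings occur because a link may come with a rank increment: [rk] controls the chains
    before the link, [rk'] those after it. *)
Lemma root_of_link rk rk' f r s :
  (forall u, rk u < #|T|) -> increasing rk f ->
  (forall u, rk' u < #|T|) -> increasing rk' (link f r s) ->
  f r = r -> f s = s -> r != s ->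
  root_of (link f r s) =1 (fun u => if root_of f u == r then s else root_of f u).
Proof.
move=> rk_lt inc rk'_lt inc' fr fs rs; apply: (root_of_unique rk'_lt inc') => u.
  rewrite /link; have [->|_] := eqVneq u r; last by rewrite (root_of_step rk_lt inc).
  by rewrite !root_of_fixed // eqxx eq_sym (negPf rs).
rewrite /link; case: eqVneq => [-> /esym /eqP|ur fu]; first by rewrite (negPf rs).
by rewrite root_of_fixed // (negPf ur).
Qed.

(** The symmetric closure of the graph of [f] and the edge from [x] to [y]: the relation under the
    star in the specification. *)
Definition graph_with_edge f x y : rel T :=
  [rel u v | [|| f u == v, (u == x) && (v == y), f v == u | (v == x) && (u == y)]].

(** Every vertex is connected to its [g]-value, and [g] is constant along each edge, so [g] picks
    one representative per component. *)
Lemma connect_graph_with_edge rk f g x y :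
  (forall u, rk u < #|T|) -> increasing rk f ->
  (forall u, g u = if root_of f u == root_of f x then root_of f y else root_of f u) ->
  forall u v, connect (graph_with_edge f x y) u v = (g u == g v).
Proof.
move=> rk_lt inc gE u v; set e := graph_with_edge f x y.
have e_sym : connect_sym e.
  by apply: sym_connect_sym => w z; rewrite /e /graph_with_edge /= orbA orbC -orbA.
have e_root w : connect e w (root_of f w).
  apply: connect_sub (fconnect_root f w) => a b /= /eqP ab.
  by apply: connect1; rewrite /e /graph_with_edge /= ab eqxx.
have xy : connect e x y by apply: connect1; rewrite /e /graph_with_edge /= !eqxx orbT.
(* In the class of [x] the walk goes from [w] to the common root, back to [x], across the new edge
   to [y], and up to the root of [y]. *)
have e_g w : connect e w (g w).
  rewrite gE; case: eqP => // wx; apply: connect_trans (e_root w) _; rewrite wx e_sym.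
  by rewrite e_sym; apply: connect_trans (e_root y); apply: connect_trans xy; rewrite e_sym.
apply/idP/eqP => [|guv]; last first.
  by apply: connect_trans (e_g u) _; rewrite guv e_sym.
have gf w : g (f w) = g w by rewrite !gE (root_of_step rk_lt inc).
have gxy : g x = g y by rewrite !gE eqxx; case: ifP.
case/connectP=> q eq ->; elim: q u eq => //= w q IHq u /andP[uw /IHq <-].
by case/or4P: uw => [/eqP <-|/andP[/eqP -> /eqP ->]|/eqP <-|/andP[/eqP -> /eqP ->]].
Qed.

(** Lets a link in the opposite direction reuse [connect_link]. *)
Lemma connect_graph_with_edgeC f x y :
  connect (graph_with_edge f x y) =2 connect (graph_with_edge f y x).
Proof.
apply: eq_connect => u v.
rewrite /graph_with_edge /= [(u == y) && _]andbC [(v == y) && _]andbC.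
by case: (f u == v); case: (_ && _); case: (f v == u); case: (_ && _).
Qed.

(** The link acts on the compressed [f'] while the graph comes from the original [f]; equality of
    the root maps bridges the two. *)
Lemma connect_link rk rk' f f' x y :
  (forall u, rk u < #|T|) -> increasing rk f -> increasing rk f' ->
  root_of f' =1 root_of f -> root_of f x != root_of f y ->
  (forall u, rk' u < #|T|) -> increasing rk' (link f' (root_of f x) (root_of f y)) ->
  let f'' := link f' (root_of f x) (root_of f y) in
  forall u v, connect (graph_with_edge f x y) u v = (root_of f'' u == root_of f'' v).
Proof.
move=> lt inc inc' ff' xy lt' inc''; apply: (connect_graph_with_edge lt inc) => u.
by rewrite (root_of_link lt inc' lt' inc'') ?ff' // -ff' (root_of_fix lt inc').
Qed.

(** * Counting roots against the ranks not below the maximum *)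

Variable num : T -> nat.
Hypotheses (num_inj : injective num) (num_lt : forall u, num u < #|T|).

Definition fixpoints f := [set u | f u == u].
Definition high (k : T -> T) := [set w | [forall q, num (k q) <= num w]].
Definition ranked f (k : T -> T) := increasing (num \o k) f /\ #|fixpoints f| <= #|high k|.

Lemma ranked_compress f k x : ranked f k -> ranked (compress f x) k.
Proof.
move=> [inc le]; have lt u : (num \o k) u < #|T| by exact: num_lt.
split; first exact: increasing_compress lt inc _.
rewrite (_ : fixpoints _ = fixpoints f) //; apply/setP => u.
by rewrite !inE (compress_fix lt inc).
Qed.

Lemma card_fixpoints_link f r s : f r = r -> r != s -> #|fixpoints f| = #|fixpoints (link f r s)|.+1.
Proof.
move=> fr rs; rewrite (cardsD1 r) inE fr eqxx add1n; congr S; apply: eq_card => u.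
by rewrite !inE /link; case: eqVneq => [->|//]; rewrite [RHS]eq_sym (negPf rs).
Qed.

Lemma ranked_link f k r s :
  ranked f k -> f r = r -> r != s -> num (k r) < num (k s) -> ranked (link f r s) k.
Proof.
move=> [inc le] fr rs krs; split; last by rewrite (leq_trans _ le) // (card_fixpoints_link fr rs).
by move=> u; rewrite /link; have [->|_] := eqVneq u r; [move=> _; exact: krs|exact: inc].
Qed.

(* Two roots leave room for a rank above the maximum, so the successor of [k r] does not wrap around. *)
Lemma ranked_room f k r s :
  ranked f k -> f r = r -> f s = s -> r != s -> exists w, num (k r) < num w.
Proof.
move=> [_ le] fr fs rs; have : 1 < #|high k|.
  apply: leq_trans le; apply: (@leq_trans #|[set r; s]|); first by rewrite cards2 rs.
  apply/subset_leq_card/subsetP => u; rewrite !inE => /orP[/eqP ->|/eqP ->]; exact/eqP.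
case/card_gt1P=> a [b []]; rewrite !inE => /forallP/(_ r) ra /forallP/(_ r) rb ab.
have [aE|aE] := eqVneq (num a) (num (k r)); last by exists a; lia.
exists b; rewrite ltn_neqAle rb andbT -aE; apply: contraNneq ab => /num_inj ->.
by rewrite eqxx.
Qed.

(** A high rank other than [k s] lies strictly above [k s], hence at or above [t]. So at most one
    high rank is lost, and the link removes one root. *)
Lemma ranked_link_incr f k r s t :
  ranked f k -> f r = r -> f s = s -> r != s -> k r = k s -> num t = (num (k s)).+1 ->
  ranked (link f r s) (link k s t).
Proof.
move=> [inc le] fr fs rs krs numt; split=> [u|] /=.
  rewrite /link; have [-> _|ur fu] := eqVneq u r.
    by rewrite (negPf rs) eqxx krs numt.
  have us : u != s by apply: contraNneq fu => ->; rewrite fs.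
  by rewrite (negPf us); have := inc u fu; rewrite /=; case: eqP => [->|]; lia.
rewrite -ltnS -(card_fixpoints_link fr rs) (leq_trans le) // (cardsD1 (k s)).
apply: (@leq_trans (1 + #|high k :\ k s|)); first by rewrite leq_add2r; case: (_ \in _).
rewrite add1n ltnS; apply/subset_leq_card/subsetP => w.
rewrite !inE => /andP[wks /forallP kw]; apply/forallP => q; rewrite /link; case: eqP => // _.
rewrite numt ltn_neqAle kw andbT; apply: contraNneq wks => /num_inj ->; exact/eqP.
Qed.

End ForestFunctions.

(** * Numbering the ranks along the cyclic successor *)

Section CyclicNumbering.
Local Open Scope nat_scope.
Variables (T : finType) (sigma : T -> T) (z : T).
Hypotheses (sigma_inj : injective sigma) (reach : forall u, fconnect sigma z u).
Implicit Types u v w : T.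

Definition num u := findex sigma z u.

Lemma num_inj : injective num.
Proof. by move=> u v uv; rewrite -(iter_findex (reach u)) -/(num u) uv iter_findex. Qed.

Lemma num_lt u : num u < #|T|.
Proof. exact: leq_trans (findex_max (reach u)) (max_card _). Qed.

(** If [u] were the last element of the orbit, one more step would close the cycle at [z]. *)
Lemma num_succ u : sigma u != z -> num (sigma u) = (num u).+1.
Proof.
move=> suz; rewrite -{1}(iter_findex (reach u)) -iterS {1}/num findex_iter //.
rewrite ltn_neqAle findex_max // andbT; apply: contraNneq suz => numu.
by rewrite -{1}(iter_findex (reach u)) -iterS numu iter_order.
Qed.

Lemma succ_neq_start u w : num u < num w -> sigma u != z.
Proof.
move=> uw; rewrite -{1}(iter_findex (reach u)) -iterS.
have lt : (num u).+1 < order sigma z by apply: leq_ltn_trans uw (findex_max (reach w)).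
by rewrite eq_sym -(findex_eq0 sigma) findex_iter.
Qed.

Definition succ_step : rel T := fun u v => (sigma u == v) && (v != z).

(** Deleting the step into [z] cuts the cycle into a line, on which reachability in at least one
    step is the strict order. *)
Lemma succ_plusP u v :
  [exists w, succ_step u w && connect succ_step w v] = (num u < num v).
Proof.
have step w t : succ_step w t -> num t = (num w).+1.
  by case/andP=> /eqP <-; exact: num_succ.
have climb w t : connect succ_step w t -> num w <= num t.
  case/connectP=> q eq ->; elim: q w eq => //= s q IHq w /andP[/step ws /IHq].
  by rewrite ws; exact: ltnW.
apply/existsP/idP => [[w /andP[/step <- /climb //]]|uv].
have suz := succ_neq_start uv; exists (sigma u).
rewrite {1}/succ_step eqxx suz /=; move: uv; rewrite -(num_succ suz).
(* Strong induction on the distance that remains from [w] to [v]. *)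
move: (sigma u) => w {u suz}; have [n] := ubnP (num v - num w).
elim: n w => // n IHn w nvw; have [/num_inj -> //|ne le] := eqVneq (num w) (num v).
have swz : sigma w != z by apply: (@succ_neq_start _ v); rewrite ltn_neqAle ne.
apply: (@connect_trans _ _ (sigma w)); first by apply: connect1; rewrite /succ_step eqxx.
by apply: IHn; rewrite num_succ //; lia.
Qed.

End CyclicNumbering.

(** * Points and relations between them *)

Import Order.TTheory Order.CTBDistrLatticeTheory.
Local Open Scope order_scope.
Local Open Scope kra_scope.

Section KleeneRelAlgTheory.
Context {d : Order.disp_t} {A : kleeneRelAlgType d}.
Implicit Types a b c u v w : A.

Lemma kmul_le a b u v : a <= b -> u <= v -> a * u <= b * v.
Proof.
move=> ab uv; apply: (@le_trans _ _ (b * u)).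
  by rewrite leEjoin -kmulUl (join_idPr ab).
by rewrite leEjoin -kmulUr (join_idPr uv).
Qed.

Lemma kconv_le a b : (a^T <= b^T) = (a <= b).
Proof.
have conv_le u v : u <= v -> u^T <= v^T.
  by move=> uv; rewrite leEjoin -kconvU (join_idPr uv).
by apply/idP/idP=> /conv_le //; rewrite !kconvK.
Qed.

Lemma kconvI a b : (a `&` b)^T = a^T `&` b^T.
Proof.
apply/le_anti/andP; split; first by rewrite lexI !kconv_le leIl leIr.
have conv_adj u v : u <= v^T -> u^T <= v by rewrite -kconv_le kconvK.
by rewrite -kconv_le kconvK lexI !conv_adj ?leIl ?leIr.
Qed.

Lemma kdedekindr a b c : (a * b) `&` c <= (a `&` (c * b^T)) * b.
Proof.
rewrite -kconv_le kconvI kconvM; apply: le_trans (kdedekind _ _ _) _.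
by rewrite kconvM kconvI kconvM !kconvK.
Qed.

Lemma kmul_top_ge a : a <= a * \top.
Proof. by rewrite -{1}[a]kmulx1 kmul_le ?lex1. Qed.

Lemma kvectorI a b : kvector a -> kvector b -> kvector (a `&` b).
Proof.
move=> /eqP av /eqP bv; apply/eqP/le_anti; rewrite kmul_top_ge andbT lexI.
by rewrite -{2}av -{3}bv !kmul_le ?leIl ?leIr.
Qed.

Lemma kvectorM a b : kvector b -> kvector (a * b).
Proof. by move=> /eqP bv; rewrite /kvector -kmulA bv. Qed.

Lemma kmul_joinsr (I : Type) (r : seq I) (P : pred I) (F : I -> A) a :
  a * (\join_(i <- r | P i) F i) = \join_(i <- r | P i) (a * F i).
Proof. exact: (big_morph _ (kmulUr a) (kmulx0 a)). Qed.

(** Injectivity [v * v^T <= 1] and surjectivity [1 <= v^T * v] are the two halves of an adjunction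
    that moves [v] across the inequality. *)
Lemma point_shunt a b v : kpoint v -> (a <= b * v) = (a * v^T <= b).
Proof.
case/and3P=> vi vs _; apply/idP/idP => h.
  apply: (@le_trans _ _ (b * (v * v^T))); first by rewrite kmulA kmul_le.
  by rewrite -{2}[b]kmulx1 kmul_le.
apply: (@le_trans _ _ (a * (v^T * v))); last by rewrite kmulA kmul_le.
by rewrite -{1}[a]kmulx1 kmul_le.
Qed.

(** Surjectivity of [u] and injectivity of [v] give [v <= v * u^T * u <= v * v^T * u <= u]. *)
Lemma kpoint_le u v : kpoint u -> kpoint v -> u <= v -> u = v.
Proof.
move=> /and3P[_ us _] /and3P[vi _ _] uv; apply/le_anti/andP; split => //.
apply: (@le_trans _ _ (v * (u^T * u))); first by rewrite -{1}[v]kmulx1 kmul_le.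
rewrite kmulA -[X in _ <= X]kmul1x kmul_le //; apply: le_trans vi.
by rewrite kmul_le // kconv_le.
Qed.

Lemma kpoint_topl v : kpoint v -> \top * v = \top.
Proof. by move=> vp; apply/le_anti; rewrite lex1 point_shunt // lex1. Qed.

Lemma kpoint_img (s z : A) : kinjective s -> kmapping s -> kpoint z -> kpoint (s^T * z).
Proof.
move=> si /andP[su st] /and3P[zi zs zv]; apply/and3P; split.
- rewrite /kinjective kconvM kconvK kmulA -[_ * z * _]kmulA.
  apply: le_trans su; rewrite kmul_le //.
  by rewrite -[X in _ <= X]kmulx1 kmul_le.
- rewrite /ksurjective kconvM kconvK kmulA -[_ * s * _]kmulA.
  apply: le_trans zs _; rewrite kmul_le //.
  by rewrite -{1}[z^T]kmulx1 kmul_le.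
- exact: kvectorM.
Qed.

Lemma kpoint_neq0 v : (1 : A) != \bot -> kpoint v -> v != \bot.
Proof.
move=> nt /and3P[_ vs _]; apply: contraNneq nt => v0.
by move: vs; rewrite /ksurjective v0 kmulx0 lex0.
Qed.

(** The Tarski rule yields [\top * w = \top], which the Dedekind rule turns into surjectivity;
    injectivity is inherited from [v]. So [w] is a point below a point. *)
Lemma kvector_le_point w v :
  tarski_rule A -> kvector w -> kpoint v -> w <= v -> w != \bot -> w = v.
Proof.
move=> tarskiA wv vp wlev w0; apply: kpoint_le => //; case/and3P: vp => vi _ _.
have topw : \top * w = \top by rewrite -(eqP wv) kmulA tarskiA.
apply/and3P; split=> //.
  by apply: le_trans vi; rewrite kmul_le // kconv_le.
rewrite /ksurjective.
have := kdedekindr \top w 1; rewrite topw !meet1x kmul1x => /le_trans; exact.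
Qed.

End KleeneRelAlgTheory.

(** * Elements of the algebra as sets of pairs of points *)

Section PointRelations.
Context {d : Order.disp_t} {A : finKleeneRelAlgType d}.

Definition point := {v : A | kpoint v}.
Definition el (a : A) (u v : point) : bool := val u <= a * val v.

Hypothesis tarskiA : tarski_rule A.
Hypothesis nontrivial : (1 : A) != \bot.
Hypothesis points_cover : \top <= \join_(v : point) val v.
Implicit Types (a b c : A) (u v w x y : point).

(** With [a] alone on the right, meets, transposes and inclusions are immediate; the defining form
    suits joins and products. *)
Lemma elE a u v : el a u v = (val u * (val v)^T <= a).
Proof. exact: point_shunt (valP v). Qed.

Lemma point_meet_vector u a : kvector a -> ~~ (val u <= a) -> val u `&` a = \bot.
Proof.
move=> wv; apply: contraNeq => n0.
have /and3P[_ _ uv] := valP u.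
by rewrite -(kvector_le_point tarskiA (kvectorI uv wv) (valP u)) ?leIl ?leIr.
Qed.

(** A point that misses every joinand is disjoint from each of them, since it is an atom among
    vectors, hence from a join above it, and would be zero. *)
Lemma point_le_joins u (I : finType) (P : pred I) (F : I -> A) :
  (forall i, P i -> kvector (F i)) ->
  (val u <= \join_(i | P i) F i) = [exists i, P i && (val u <= F i)].
Proof.
move=> Fv; apply/idP/existsP => [|[i /andP[Pi uF]]]; last exact: joins_min Pi uF.
move=> uF; apply/existsP; apply: contraT => /existsPn nF.
case/negP: (kpoint_neq0 nontrivial (valP u)).
rewrite -(meet_idPl uF) joins_disjoint // => i Pi.
by apply: point_meet_vector; [apply: Fv | move: (nF i); rewrite Pi].
Qed.

Lemma val_vector u : kvector (val u).
Proof. by case/and3P: (valP u). Qed.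

(** Meet the cover of [\top] with [a]: each point is either below [a] or disjoint from it. *)
Lemma vector_joins a : kvector a -> a <= \join_(v : point | val v <= a) val v.
Proof.
move=> av; rewrite -{1}[a]meet1x.
apply: (@le_trans _ _ ((\join_(v : point) val v) `&` a)); first by rewrite leI2.
rewrite (big_morph (fun b => b `&` a) (fun b c => meetUl b c a) (meet0x a)).
apply/joinsP => v _; have [va|va] := boolP (val v <= a).
  by apply: le_trans (leIl _ _) _; apply: joins_sup.
by rewrite point_meet_vector ?le0x.
Qed.

Lemma elU a b u v : el (a `|` b) u v = el a u v || el b u v.
Proof.
rewrite /el kmulUl.
have av c : kvector (c * val v) by apply/kvectorM/val_vector.
apply/idP/orP => [uab|[] h]; [|by rewrite lexU2 ?h|by rewrite lexU2 ?h ?orbT].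
apply/orP; rewrite -[_ || _]negbK negb_or; apply/negP => /andP[na nb].
case/negP: (kpoint_neq0 nontrivial (valP u)).
by rewrite -(meet_idPl uab) meetUr !point_meet_vector ?joinxx.
Qed.

Lemma elI a b u v : el (a `&` b) u v = el a u v && el b u v.
Proof. by rewrite !elE lexI. Qed.

Lemma el_top u v : el \top u v.
Proof. by rewrite elE lex1. Qed.

Lemma el_bot u v : el \bot u v = false.
Proof.
rewrite /el kmul0x lex0; exact/negbTE/(kpoint_neq0 nontrivial (valP u)).
Qed.

Lemma elC a u v : el (~` a) u v = ~~ el a u v.
Proof.
have := elI a (~` a) u v; have := elU a (~` a) u v.
by rewrite joinxC meetxC el_top el_bot; case: (el a u v); case: (el _ u v).
Qed.

Lemma elT a u v : el a^T u v = el a v u.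
Proof. by rewrite !elE -kconv_le kconvM !kconvK. Qed.

Lemma el1 u v : el 1 u v = (u == v).
Proof.
rewrite /el kmul1x; apply/idP/eqP => [|-> //].
by move/(kpoint_le (valP u) (valP v))/val_inj.
Qed.

Lemma elV a u v : kvector a -> el a u v = (val u <= a).
Proof. by move=> /eqP <-; rewrite /el -kmulA kpoint_topl ?(valP v). Qed.

Lemma el_point u v w : el (val u) v w = (v == u).
Proof. by rewrite elV ?val_vector // -el1 /el kmul1x. Qed.

(** The difference of [a] and [b] sends each point to a vector that contains no point, so to zero;
    as the points cover [\top], it is zero itself. *)
Lemma el_sub a b : (forall u v, el a u v -> el b u v) -> a <= b.
Proof.
move=> ab; rewrite -Order.CBDistrLatticeTheory.diff_eq0 diffE; set c := _ `&` _.
have cv v : c * val v = \bot.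
  apply/eqP; rewrite -lex0; apply: le_trans (vector_joins _) _.
    exact/kvectorM/val_vector.
  apply/joinsP => u; rewrite -[_ <= _]/(el c u v) /c elI elC.
  by case/andP=> /ab ->.
rewrite -lex0; apply: le_trans (kmul_top_ge c) _.
apply: le_trans (kmul_le (lexx c) points_cover) _.
by rewrite kmul_joinsr; apply/joinsP => v _; rewrite cv.
Qed.

Lemma el_ext a b : (forall u v, el a u v = el b u v) -> a = b.
Proof. by move=> ab; apply/le_anti/andP; split; apply: el_sub => u v; rewrite ab. Qed.

Lemma el_leP a b : reflect (forall u v, el a u v -> el b u v) (a <= b).
Proof.
apply: (iffP idP) => [ab u v|]; last exact: el_sub.
by rewrite !elE => /le_trans; apply.
Qed.

(** The middle point comes from splitting the vector [b * val v] into points, one of which has an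
    image under [a] above [u]. *)
Lemma elM a b u v : el (a * b) u v = [exists w, el a u w && el b w v].
Proof.
apply/idP/existsP => [|[w /andP[uw wv]]].
  rewrite {1}/el -kmulA => uab.
  have /vector_joins bv : kvector (b * val v) by apply/kvectorM/val_vector.
  have := le_trans uab (kmul_le (lexx a) bv).
  rewrite kmul_joinsr point_le_joins => [/existsP[w /andP[wv uw]]|w _].
    by exists w; rewrite /el uw.
  exact/kvectorM/val_vector.
by rewrite /el -kmulA (le_trans uw) // kmul_le.
Qed.

Lemma elM_point a u v w : el (a * val w) u v = el a u w.
Proof.
rewrite elM; apply/existsP/idP => [[t]|uw]; last by exists w; rewrite uw el_point eqxx.
by rewrite el_point => /andP[? /eqP <-].
Qed.

Lemma el_joins (I : finType) (P : pred I) (F : I -> A) u v :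
  el (\join_(i | P i) F i) u v = [exists i, P i && el (F i) u v].
Proof.
rewrite {1}/el (big_morph (fun a => a * val v)
  (fun a b => kmulUl a b (val v)) (kmul0x (val v))) point_le_joins //.
by move=> i _; apply/kvectorM/val_vector.
Qed.

Lemma el_outer x y u v : el (val x * (val y)^T) u v = (u == x) && (v == y).
Proof.
rewrite elM; apply/existsP/andP => [[w]|[/eqP <- /eqP <-]].
  by rewrite elT !el_point => /andP[].
by exists u; rewrite elT !el_point !eqxx.
Qed.

Definition of_rel (r : rel point) : A :=
  \join_(uv : point * point | r uv.1 uv.2) (val uv.1 * (val uv.2)^T).

Lemma el_of_rel r u v : el (of_rel r) u v = r u v.
Proof.
rewrite el_joins; apply/existsP/idP => [[[u' v']]|uv].
  by rewrite el_outer => /andP[/= + /andP[/eqP -> /eqP ->]].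
by exists (u, v); rewrite el_outer uv !eqxx.
Qed.

Lemma el_star a u v : el a^* u v = connect (el a) u v.
Proof.
apply/idP/idP => [|/connectP[s]].
  (* Connectivity is itself an element of the algebra, so star induction can bound the star by
     it. *)
  have /el_leP : a^* <= of_rel (connect (el a)).
    rewrite -[_^*]kmulx1; apply: kstar_inductl; apply: el_sub => u' v'.
    rewrite elU el1 elM el_of_rel => /orP[/eqP -> //|/existsP[w]].
    by rewrite el_of_rel => /andP[/connect1]; apply: connect_trans.
  by move=> h /h; rewrite el_of_rel.
rewrite -kstar_unfoldl; elim: s u => [|w s IHs] u /=; first by move=> _ ->; rewrite elU el1 eqxx.
case/andP=> uw /IHs ws /ws {}ws; rewrite elU elM; apply/orP; right.
by apply/existsP; exists w; rewrite uw -kstar_unfoldl.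
Qed.

Lemma el_plus a u v : el (kplus a) u v = [exists w, el a u w && connect (el a) w v].
Proof. by rewrite elM; apply: eq_existsb => w; rewrite el_star. Qed.

Definition of_fun (f : point -> point) : A := of_rel (frel f).

Lemma el_of_fun f u v : el (of_fun f) u v = (f u == v).
Proof. exact: el_of_rel. Qed.

Lemma el_of_fun_star f u v : el (of_fun f)^* u v = fconnect f u v.
Proof. by rewrite el_star; apply: eq_connect => ? ?; rewrite el_of_fun. Qed.

Lemma el_of_fun_starT f u v : el (of_fun f)^T^* u v = fconnect f v u.
Proof.
rewrite el_star; have /= <- := connect_rev (frel f) u v.
by apply: eq_connect => w t; rewrite elT el_of_fun.
Qed.

Lemma kmapping_of_fun f : kmapping (of_fun f).
Proof.
apply/andP; split; apply: el_sub => u v; rewrite elM.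
  by case/existsP=> w; rewrite elT !el_of_fun el1 => /andP[/eqP <-].
rewrite el1 => /eqP <-; apply/existsP; exists (f u).
by rewrite elT el_of_fun eqxx.
Qed.

Lemma kmappingP a : kmapping a -> exists f, a = of_fun f.
Proof.
case/andP=> /el_leP auni /el_leP atot.
have tot u : exists w, el a u w.
  have := atot u u; rewrite el1 eqxx elM => /(_ isT)/existsP[w /andP[uw _]].
  by exists w.
exists (fun u => xchoose (tot u)); apply: el_ext => u v; rewrite el_of_fun.
have uc := xchooseP (tot u); apply/idP/eqP => [uv|<- //].
apply/eqP; rewrite -el1; apply: auni; rewrite elM.
by apply/existsP; exists u; rewrite elT uc.
Qed.

Lemma kinjective_of_fun f : kinjective (of_fun f) -> injective f.
Proof.
move=> /el_leP finj u v fuv; apply/eqP; rewrite -el1; apply: finj; rewrite elM.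
by apply/existsP; exists (f u); rewrite elT !el_of_fun fuv eqxx.
Qed.

End PointRelations.

Arguments point {d} A.


(** The join of all points contains [Z] and is closed under [S^T], which maps points to points; star
    induction does the rest. *)
Lemma points_cover_of_generation d (A : finKleeneRelAlgType d) (Z S : A) :
  kpoint Z -> kinjective S -> kmapping S -> S^T^* * Z = \top ->
  \top <= \join_(v : point A) val v.
Proof.
move=> Zp Si Sm <-; apply: kstar_inductl; rewrite leUx; apply/andP; split.
  have /= := @joins_sup _ A (point A) (exist _ Z Zp) xpredT (fun v => val v); exact.
rewrite kmul_joinsr; apply/joinsP => v _; have Sv := kpoint_img Si Sm (valP v).
have /= := @joins_sup _ A (point A) (exist (fun a => is_true (kpoint a)) _ Sv) xpredT (fun v => val v); exact.
Qed.

(** * Union by rank on the points *)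

(** Naming the intermediate values by equations allows each one to be replaced by its functional
    counterpart as soon as it is known. *)
Lemma union_by_rankE {d : Order.disp_t} {A : kleeneRelAlgType d}
    (S' p rank x y r0 s0 r s p1 p2 : A) :
  kroot p x = r -> kupdate p (p^T^* * x) r = p1 ->
  kroot p1 y = s -> kupdate p1 (p1^T^* * y) s = p2 ->
  union_by_rank S' (State p rank x y r0 s0) =
    if r != s then
      if rank^T * r <= kplus S' * rank^T * s then State (kupdate p2 r s) rank x y r s
      else if rank^T * r == rank^T * s then
        State (kupdate p2 s r) (kupdate rank r (S'^T * rank^T * r)) x y r s
      else State (kupdate p2 s r) rank x y r s
    else State p2 rank x y r s.
Proof. by move=> <- <- <- <-. Qed.

Section ForestRelations.
Context {d : Order.disp_t} {A : finKleeneRelAlgType d}.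
Hypothesis tarskiA : tarski_rule A.
Hypothesis nontrivial : (1 : A) != \bot.
Hypothesis points_cover : \top <= \join_(v : point A) val v.
Variables (z : point A) (sigma : point A -> point A).
Hypotheses (sigma_inj : injective sigma) (reach : forall u, fconnect sigma z u).
Implicit Types (f k : point A -> point A) (u v w x y r s t : point A).

Let S' : A := succ' (val z) (of_fun sigma).
Let N := num sigma z.
Let N_inj : injective N := num_inj reach.
Let N_lt : forall u, (N u < #|{: point A}|)%N := num_lt reach.

Let eC := elC tarskiA nontrivial.
Let eU := elU tarskiA nontrivial.
Let eM := elM tarskiA nontrivial points_cover.
Let eF := el_of_fun tarskiA nontrivial points_cover.
Let ext := el_ext tarskiA nontrivial points_cover.
Let sub := el_sub tarskiA nontrivial points_cover.
Let leP := el_leP tarskiA nontrivial points_cover.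

Lemma el_succ' u v : el S' u v = succ_step sigma z u v.
Proof. by rewrite elI eC elT eF el_point. Qed.

Lemma el_succ'_plus u v : el (kplus S') u v = (N u < N v)%N.
Proof.
rewrite el_plus // -(succ_plusP sigma_inj reach).
apply: eq_existsb => w; rewrite el_succ'; congr (_ && _).
by apply: eq_connect => a b; rewrite el_succ'.
Qed.

Lemma of_funT_point f u : (of_fun f)^T * val u = val (f u) :> A.
Proof. by apply: ext => v w; rewrite elM_point // elT eF el_point [RHS]eq_sym. Qed.

Lemma succ'T_point u : sigma u != z -> S'^T * val u = val (sigma u) :> A.
Proof.
move=> suz; apply: ext => v w.
rewrite elM_point // elT el_succ' el_point [RHS]eq_sym /succ_step.
by case: eqVneq => // <-; rewrite suz.
Qed.

Lemma rank_test k u v :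
  ((of_fun k)^T * val u <= kplus S' * (of_fun k)^T * val v) = (N (k u) < N (k v))%N.
Proof.
rewrite -[kplus _ * _ * _]kmulA !of_funT_point.
by rewrite -[_ <= _]/(el (kplus S') (k u) (k v)) el_succ'_plus.
Qed.

Lemma el_fixpoints f u v : el ((of_fun f `&` 1) * \top) u v = (f u == u).
Proof.
rewrite eM; apply/existsP/idP => [[w]|fu].
  by rewrite elI eF el1 => /andP[/andP[/eqP <- /eqP <-]].
by exists u; rewrite elI eF el1 el_top fu eqxx.
Qed.

Lemma kroot_of_fun (rk : point A -> nat) f x :
  (forall u, rk u < #|{: point A}|)%N -> increasing rk f ->
  kroot (of_fun f) (val x) = val (root_of f x).
Proof.
move=> lt inc; apply: ext => u v; rewrite elI el_fixpoints elM_point //.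
by rewrite el_of_fun_starT // el_point (root_ofP lt inc).
Qed.

Lemma kupdate_of_fun f g (a : A) s :
  (forall u v, el a u v -> g u = s) -> (forall u v, ~~ el a u v -> g u = f u) ->
  kupdate (of_fun f) a (val s) = of_fun g.
Proof.
move=> gin gout; apply: ext => u v.
rewrite eU !elI eC elT !eF el_point.
have [uv|uv] := boolP (el a u v); first by rewrite (gin _ _ uv) orbF eq_sym.
by rewrite (gout _ _ uv).
Qed.

Lemma kupdate_compress f x :
  kupdate (of_fun f) ((of_fun f)^T^* * val x) (val (root_of f x)) = of_fun (compress f x).
Proof.
apply: kupdate_of_fun => u v; rewrite elM_point // el_of_fun_starT // /compress.
  by move->.
by move/negbTE->.
Qed.

Lemma kupdate_link f r s : kupdate (of_fun f) (val r) (val s) = of_fun (link f r s).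
Proof.
by apply: kupdate_of_fun => u v; rewrite el_point // /link; [move=> -> | move/negbTE->].
Qed.

(** The increase condition is read point by point, and the existence of [i] becomes a comparison of
    cardinalities by [card_le_inj_on]. *)
Lemma rank_propertyP f k : rank_property S' (of_fun f) (of_fun k) <-> ranked N f k.
Proof.
have el_fn : forall u v,
    el ((of_fun f `&` ~` 1) * of_fun k) u v = (f u != u) && (k (f u) == v).
  move=> u v; rewrite eM; apply/existsP/idP => [[w]|/andP[fu kv]].
    by rewrite elI eC !eF el1 => /andP[/andP[/eqP <- fu] ->]; rewrite eq_sym fu.
  by exists (f u); rewrite elI eC !eF el1 eqxx kv eq_sym fu.
have el_rk u v : el (of_fun k * kplus S') u v = (N (k u) < N v)%N.
  rewrite eM; apply/existsP/idP => [[w]|kv].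
    by rewrite eF el_succ'_plus => /andP[/eqP <-].
  by exists (k u); rewrite eF el_succ'_plus eqxx.
have el_hi u v : el (~` (kplus S' * (of_fun k)^T * \top)) u v = (u \in high N k).
  rewrite eC inE -[RHS]negbK negb_forall; congr (~~ _).
  rewrite -kmulA eM; apply/existsP/existsP => [[w]|[w]].
    rewrite el_succ'_plus eM => /andP[uw /existsP[q]].
    by rewrite elT eF => /andP[/eqP kq _]; exists q; rewrite -ltnNge kq.
  rewrite -ltnNge => uw; exists (k w); rewrite el_succ'_plus uw eM /=.
  by apply/existsP; exists w; rewrite elT eF eqxx el_top.
split=> [[_ /leP inc [i [/leP iinj /leP iuni /leP ile]]]|[inc]].
  split=> [u fu|]; first by have := inc u (k (f u)); rewrite el_fn el_rk fu eqxx; exact.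
  have root_high u : u \in fixpoints f -> exists w, el i u w && (w \in high N k).
    rewrite inE => fu; have := ile u u; rewrite el_fixpoints fu eM => /(_ isT)/existsP.
    by case=> w; rewrite el_hi; exists w.
  apply/card_le_inj_on.
  (* Any high rank that [i] relates to [u] will do; the default occurs only where there is none,
     hence never at a root. *)
  pose h u := odflt u [pick w | el i u w && (w \in high N k)].
  have hP u : u \in fixpoints f -> el i u (h u) && (h u \in high N k).
    by move=> /root_high[w uw]; rewrite /h; case: pickP => //= /(_ w); rewrite uw.
  exists h; split=> [u v /hP/andP[uh _] /hP/andP[vh _] huv|u /hP/andP[]//].
  apply/eqP; rewrite -el1; apply: iinj; rewrite eM.
  by apply/existsP; exists (h u); rewrite elT uh huv vh.
case/card_le_inj_on=> h [hinj hhigh]; split; first exact: kmapping_of_fun.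
  by apply: sub => u v; rewrite el_fn el_rk => /andP[fu /eqP <-]; apply: inc.
(* [h] is known to be injective only on the roots, so its graph is restricted to them. *)
exists (of_rel [rel u w | (u \in fixpoints f) && (h u == w)]); split; apply: sub => u v; rewrite eM.
- case/existsP=> w; rewrite elT !el_of_rel //= el1 => /andP[/andP[ur /eqP <-] /andP[vr /eqP hvu]].
  by apply/eqP/hinj.
- by case/existsP=> w; rewrite elT !el_of_rel //= el1 => /andP[/andP[_ /eqP <-] /andP[_]].
rewrite -eM el_fixpoints eM => fu; have ur : u \in fixpoints f by rewrite inE.
by apply/existsP; exists (h u); rewrite el_of_rel //= ur eqxx el_hi hhigh.
Qed.

(** Along a cycle of non-loop steps a rank would exceed itself. *)
Lemma kforest_increasing (rk : point A -> nat) f : increasing rk f -> kforest (of_fun f).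
Proof.
move=> inc; apply/andP; split; first exact: kmapping_of_fun.
apply: sub => u v; rewrite eC el1 el_plus // => /existsP[w /andP[]].
have step a b : el (of_fun f `&` ~` 1) a b -> (rk a < rk b)%N.
  by rewrite elI eC eF el1 => /andP[/eqP <- fa]; apply: inc; rewrite eq_sym.
move=> /step uw /connectP[q wq vq]; apply/eqP => uv; rewrite -{v}uv in vq.
suff: (rk w <= rk u)%N by rewrite leqNgt uw.
rewrite vq; elim: q w wq {vq uw} => //= b q IHq a /andP[/step/ltnW ab /IHq].
exact: leq_trans.
Qed.

Lemma el_equivalence (rk : point A -> nat) f u v :
  (forall u, rk u < #|{: point A}|)%N -> increasing rk f ->
  el ((of_fun f)^* * (of_fun f)^T^*) u v = (root_of f u == root_of f v).
Proof.
move=> lt inc; rewrite eM; apply/existsP/eqP => [[w]|uv].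
  rewrite el_of_fun_star // el_of_fun_starT //.
  by case/andP=> /(root_of_connect lt inc) -> /(root_of_connect lt inc).
exists (root_of f u); rewrite el_of_fun_star // el_of_fun_starT //.
by rewrite {2}uv !fconnect_root.
Qed.

Lemma el_graph_with_edge f x y u v :
  el (of_fun f `|` val x * (val y)^T `|` (of_fun f `|` val x * (val y)^T)^T) u v
    = graph_with_edge f x y u v.
Proof. by rewrite eU elT !eU !eF !el_outer // /graph_with_edge /= -orbA. Qed.

(** Both compressions preserve all roots, so what remains is to treat equal roots and the links in
    either direction, the second with or without an increment. *)
Lemma union_by_rank_run f k x y (r0 s0 : A) :
  ranked N f k ->
  exists f' k', [/\ union_by_rank S' (State (of_fun f) (of_fun k) (val x) (val y) r0 s0)
      = State (of_fun f') (of_fun k') (val x) (val y)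
          (val (root_of f x)) (val (root_of f y)),
    ranked N f' k' &
    forall u v, connect (graph_with_edge f x y) u v = (root_of f' u == root_of f' v)].
Proof.
move=> rk; have lt u : ((N \o k) u < #|{: point A}|)%N by exact: N_lt.
have inc : increasing (N \o k) f by case: rk.
pose f1 := compress f x; have rk1 : ranked N f1 k by exact: ranked_compress.
have inc1 : increasing (N \o k) f1 by case: rk1.
pose f2 := compress f1 y; have rk2 : ranked N f2 k by exact: ranked_compress.
have inc2 : increasing (N \o k) f2 by case: rk2.
have root1 : root_of f1 =1 root_of f := root_of_compress x lt inc.
have root2 : root_of f2 =1 root_of f.
  by move=> u; rewrite (root_of_compress _ lt inc1) root1.
have f2_root u : f2 (root_of f u) = root_of f u by rewrite -root2 (root_of_fix lt inc2).
set r := root_of f x; set s := root_of f y.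
rewrite (union_by_rankE S' (of_fun k) r0 s0 (kroot_of_fun x lt inc) (kupdate_compress f x)
  (kroot_of_fun y lt inc1) (kupdate_compress f1 y)).
rewrite root1 -/f1 -/f2 -/r -/s rank_test -kmulA !of_funT_point !kupdate_link !val_eqE.
have [rs|rs] /= := eqVneq r s.
  (* With equal roots the new edge merges nothing, and the old root map already represents the
     components. *)
  exists f2, k; split=> // u v; rewrite !root2.
  apply: (connect_graph_with_edge lt inc) => w.
  by rewrite -/r -/s -rs; case: eqP.
have [krs|ksr] := ltnP.
  have rk' : ranked N (link f2 r s) k := ranked_link rk2 (f2_root x) rs krs.
  exists (link f2 r s), k; split=> //; case: rk' => inc' _.
  exact: (connect_link lt inc inc2 root2 rs lt inc').
have sr : s != r by rewrite eq_sym.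
have swapped k' : ranked N (link f2 s r) k' -> forall u v,
    connect (graph_with_edge f x y) u v
      = (root_of (link f2 s r) u == root_of (link f2 s r) v).
  move=> [inc' _] u v; rewrite connect_graph_with_edgeC.
  exact: (connect_link lt inc inc2 root2 sr (fun w => N_lt (k' w)) inc').
have [krs|krs] := eqVneq (k r) (k s).
  (* Some rank lies above [k r], so its successor is not [z] and [S'^T] agrees with [sigma]
     there. *)
  have [w /(succ_neq_start reach) skr] := ranked_room N_inj rk2 (f2_root x) (f2_root y) rs.
  have rk' : ranked N (link f2 s r) (link k r (sigma (k r))).
    apply: (ranked_link_incr N_inj rk2 (f2_root y) (f2_root x) sr) => //.
    exact: (num_succ sigma_inj reach).
  exists (link f2 s r), (link k r (sigma (k r))); split=> //; last exact: swapped rk'.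
  by rewrite succ'T_point // kupdate_link.
have rk' : ranked N (link f2 s r) k.
  apply: (ranked_link rk2 (f2_root y) sr); rewrite ltn_neqAle ksr andbT.
  by apply: contraNneq krs => /N_inj ->.
by exists (link f2 s r), k; split=> //; exact: swapped rk'.
Qed.

End ForestRelations.

(** * Transfer from functions back to the algebra *)

Theorem mainTheorem20 (d : Order.disp_t) (A : finKleeneRelAlgType d)
  (tarskiA : tarski_rule A)
  (Z S : A)
  (Zpoint : kpoint Z)
  (Sinj : kinjective S)
  (Smap : kmapping S)
  (Sgen : S^T^* * Z = \top)
  (p0 rank0 x y r0 s0 : A)
  (p0forest : kforest p0)
  (xpoint : kpoint x)
  (ypoint : kpoint y)
  (rank0P : rank_property (succ' Z S) p0 rank0) :
  let final := union_by_rank (succ' Z S) (State p0 rank0 x y r0 s0) in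
  [/\ kforest (var_p final),
      kpoint (var_x final) /\ kpoint (var_y final),
      (var_p final)^* * (var_p final)^T^*
        = (p0 `|` x * y^T `|` (p0 `|` x * y^T)^T)^* &
      rank_property (succ' Z S) (var_p final) (var_rank final)].
Proof.
(* The axioms admit the one-element algebra, where points may be zero; there all equations hold
   trivially. *)
have [triv final|nontrivial] := eqVneq (1 : A) \bot.
  have eqA (a b : A) : a = b by rewrite -[a]kmul1x -[b]kmul1x triv !kmul0x.
  rewrite (eqA (var_p final) p0) (eqA (var_rank final) rank0) (eqA (var_x final) x).
  by rewrite (eqA (var_y final) y); split=> //; apply: eqA.
have cover := points_cover_of_generation Zpoint Sinj Smap Sgen.
have [sigma Sfun] := kmappingP tarskiA nontrivial cover Smap.
have sigma_inj : injective sigma.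
  by apply: (kinjective_of_fun tarskiA nontrivial cover); rewrite -Sfun.
pose z : point A := exist _ Z Zpoint.
have reach u : fconnect sigma z u.
  rewrite -(el_of_fun_starT tarskiA nontrivial cover) -Sfun.
  (* The second [u] is an arbitrary column: the product with the point [z] is a vector, and it
     equals [\top] by the generation hypothesis. *)
  by rewrite -(elM_point tarskiA nontrivial cover _ u u) /= Sgen el_top.
case/andP: p0forest => /(kmappingP tarskiA nontrivial cover)[f p0f] _.
have [/(kmappingP tarskiA nontrivial cover)[k rank0k] _ _] := rank0P.
pose px : point A := exist _ x xpoint; pose py : point A := exist _ y ypoint.
subst S p0 rank0.
have rP := rank_propertyP tarskiA nontrivial cover sigma_inj reach.
have [f' [k' [-> rk' conn]]] := union_by_rank_run tarskiA nontrivial cover sigma_inj reach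
  px py r0 s0 ((rP f k).1 rank0P).
have inc : increasing (num sigma z \o k') f' by case: rk'.
have lt u : ((num sigma z \o k') u < #|{: point A}|)%N by exact: num_lt.
split=> //=; last exact/rP.
  exact: kforest_increasing tarskiA nontrivial cover _ _ inc.
apply: (el_ext tarskiA nontrivial cover) => u v.
rewrite (el_equivalence tarskiA nontrivial cover u v lt inc) -conn el_star //.
apply: eq_connect => a b.
by rewrite -(el_graph_with_edge tarskiA nontrivial cover).
Qed.
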